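(* Let $f$ be a SOS-convex polynomial on $\mathbb{R}^n$ and, for $i=1,\ldots,m$, let $g_i^{(0)},g_i^{(1)},\ldots,g_i^{(q_i)}$ be SOS-convex polynomials on $\mathbb{R}^n$. For $i=1,\ldots,m$, let $A_i=(A_i^{jr})\in\mathbb{R}^{l_i\times q_i}$ and $b_i=(b_i^j)\in\mathbb{R}^{l_i}$ be such that $$\bar{\mathcal{V}}_i:=\{v_i=(v_i^{(1)},\ldots,v_i^{(q_i)})\in\mathbb{R}^{q_i} : v_i^{(r)}\ge 0\ (r=1,\ldots,q_i),\ A_iv_i=b_i\}$$ is compact. Consider the problem $$(P^p)\quad\inf_{x\in\mathbb{R}^n}\Big\{f(x) : g_i^{(0)}(x)+\sum_{r=1}^{q_i}v_i^{(r)}g_i^{(r)}(x)\le 0\ \ \forall v_i\in\bar{\mathcal{V}}_i,\ i=1,\ldots,m\Big\}$$ and, for $k\in\mathbb{N}$, the relaxation problem $$(D_k^p)\quad\begin{array}{cl}\max\limits_{\mu,w_i^r}&\mu\\ \text{s.t.}& f+\sum\limits_{i=1}^m\sum\limits_{r=0}^{q_i}w_i^rg_i^{(r)}-\mu\in\Sigma^2_k,\\ &\sum\limits_{r=1}^{q_i}A_i^{jr}w_i^r=w_i^0b_i^j,\ \ \forall j=1,\ldots,l_i,\ i=1,\ldots,m,\\ &\mu\in\mathbb{R},\ w_i^r\ge 0,\ \ \forall r=0,1,\ldots,q_i,\ i=1,\ldots,m.\end{array}$$ Suppose that $$\Big\{x\in\mathbb{R}^n : g_i^{(0)}(x)+\sum_{r=1}^{q_i}v_i^{(r)}g_i^{(r)}(x)<0\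 \ \forall v_i\in\bar{\mathcal{V}}_i,\ i=1,\ldots,m\Big\}\neq\emptyset.$$ Then the minimum of $(P^p)$ is attained and $\min(P^p)=\max(D^p_{k_0})$, where $k_0$ is the smallest even number such that $k_0\ge\max_{0\le r\le q_i,\,1\le i\le m}\{\deg f,\deg g_i^{(r)}\}$.
   Context: A matrix polynomial $M\in\mathbb{R}[x]^{n\times n}$ is a SOS matrix polynomial if $M(x)=H(x)H(x)^T$ for some matrix polynomial $H\in\mathbb{R}[x]^{n\times r}$, $r\in\mathbb{N}$. A real polynomial $f$ on $\mathbb{R}^n$ is SOS-convex if its Hessian $x\mapsto\nabla^2 f(x)$ is a SOS matrix polynomial. $\Sigma^2_d$ denotes the set of all real polynomials of degree at most $d$ that are sums of squares of real polynomials. $\min(P^p)$ and $\max(D^p_{k})$ denote the optimal values of the respective problems.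
   Formalization: The formal theorem additionally assumes that f is bounded below on the feasible set of (P^p) and that each set V_i is non-empty; without these the claim fails (e.g. f = x with g^(0) = -1, g^(1) = 0; or an empty V_i making the dual unbounded). *)

(* Defs.v *)
From mathcomp Require Import all_boot all_order all_algebra.
(* mpoly must be imported before the analysis files: their notations clash in
   the other order. *)
From mathcomp Require Import mpoly.
From mathcomp Require Import classical_sets reals topology normedtype.

Set Implicit Arguments.
Unset Strict Implicit.
Unset Printing Implicit Defensive.

Import Order.TTheory GRing.Theory Num.Theory numFieldNormedType.Exports.
Local Open Scope classical_set_scope.
Local Open Scope ring_scope.

(* Total degree, with mpdeg 0 = 0. *)
Definition mpdeg (R : realType) (n : nat) (p : {mpoly R[n]}) : nat :=
  (msize p).-1.

Definition hessian (R : realType) (n : nat) (p : {mpoly R[n]}) :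
    'M[{mpoly R[n]}]_n :=
  \matrix_(i < n, j < n) mderiv j (mderiv i p).

Definition sos_matrix (R : realType) (n k : nat) (M : 'M[{mpoly R[n]}]_k) :
    Prop :=
  exists (r : nat) (H : 'M[{mpoly R[n]}]_(k, r)), M = H *m H^T.

Definition sos_convex (R : realType) (n : nat) (p : {mpoly R[n]}) : Prop :=
  sos_matrix (hessian p).

(* Sums of squares of degree at most d; the bound is on the sum itself. *)
Definition SigmaSq (R : realType) (n d : nat) : set {mpoly R[n]} :=
  [set p : {mpoly R[n]} | (mpdeg p <= d)%N
         /\ exists s : seq {mpoly R[n]}, p = \sum_(h <- s) h ^+ 2].

Definition uncertainty (R : realType) (l q : nat) (A : 'M[R]_(l, q))
    (b : 'cV[R]_l) : set 'cV[R]_q :=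
  [set v : 'cV[R]_q | (forall r : 'I_q, 0 <= v r ord0) /\ A *m v = b].

(* g ord0 is the fixed term g^(0) and g (lift ord0 r), for r : 'I_q, are
   g^(1), ..., g^(q); likewise for the multipliers w below. *)
Definition constraint (R : realType) (n q : nat)
    (g : 'I_q.+1 -> {mpoly R[n]}) (v : 'cV[R]_q) (x : 'I_n -> R) : R :=
  (g ord0).@[x] + \sum_(r < q) v r ord0 * (g (lift ord0 r)).@[x].

Definition feasible (R : realType) (n m : nat) (q l : 'I_m -> nat)
    (g : forall i : 'I_m, 'I_(q i).+1 -> {mpoly R[n]})
    (A : forall i : 'I_m, 'M[R]_(l i, q i))
    (b : forall i : 'I_m, 'cV[R]_(l i)) : set ('I_n -> R) :=
  [set x : 'I_n -> R | forall (i : 'I_m) (v : 'cV[R]_(q i)),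
             uncertainty (A i) (b i) v -> constraint (g i) v x <= 0].

Definition strictly_feasible (R : realType) (n m : nat) (q l : 'I_m -> nat)
    (g : forall i : 'I_m, 'I_(q i).+1 -> {mpoly R[n]})
    (A : forall i : 'I_m, 'M[R]_(l i, q i))
    (b : forall i : 'I_m, 'cV[R]_(l i)) : set ('I_n -> R) :=
  [set x : 'I_n -> R | forall (i : 'I_m) (v : 'cV[R]_(q i)),
             uncertainty (A i) (b i) v -> constraint (g i) v x < 0].

Definition primal_values (R : realType) (n m : nat) (q l : 'I_m -> nat)
    (f : {mpoly R[n]})
    (g : forall i : 'I_m, 'I_(q i).+1 -> {mpoly R[n]})
    (A : forall i : 'I_m, 'M[R]_(l i, q i))
    (b : forall i : 'I_m, 'cV[R]_(l i)) : set R :=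
  [set f.@[x] | x in feasible g A b].

Definition dual_values (R : realType) (n m : nat) (q l : 'I_m -> nat)
    (f : {mpoly R[n]})
    (g : forall i : 'I_m, 'I_(q i).+1 -> {mpoly R[n]})
    (A : forall i : 'I_m, 'M[R]_(l i, q i))
    (b : forall i : 'I_m, 'cV[R]_(l i)) (k : nat) : set R :=
  [set mu : R | exists w : forall i : 'I_m, 'I_(q i).+1 -> R,
      [/\ SigmaSq k (f + \sum_(i < m) \sum_(r < (q i).+1) w i r *: g i r
                       - mu%:MP),
          forall (i : 'I_m) (j : 'I_(l i)),
            \sum_(r < q i) A i j r * w i (lift ord0 r)
              = w i ord0 * b i j ord0
        & forall (i : 'I_m) (r : 'I_(q i).+1), 0 <= w i r]].

Definition is_min (R : realType) (S : set R) (v : R) : Prop :=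
  S v /\ lbound S v.

Definition is_max (R : realType) (S : set R) (v : R) : Prop :=
  S v /\ ubound S v.

Definition smallest_even_ge (d k : nat) : Prop :=
  [/\ ~~ odd k, (d <= k)%N
    & forall j : nat, ~~ odd j -> (d <= j)%N -> (k <= j)%N].

(* Main.v *)
Require Import Defs.
From mathcomp Require Import all_boot all_order all_algebra.
From mathcomp Require Import mpoly.
From mathcomp Require Import classical_sets reals topology normedtype.
From mathcomp Require Import boolp polyrcf ring lra.

Set Implicit Arguments.
Unset Strict Implicit.
Unset Printing Implicit Defensive.

Import Order.TTheory GRing.Theory Num.Theory numFieldNormedType.Exports.
Local Open Scope classical_set_scope.
Local Open Scope ring_scope.

(** The inner maximisation of a robust constraint over its polytope is a linear
    programme in [v].  Replacing it by the existence of a dual feasible vector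
    turns the semi-infinite problem into an ordinary convex one in the variables
    [(x, y_1, ..., y_m)], with finitely many constraints
    [g_i^(0)(x) + b_i . y_i <= 0] and [g_i^(r)(x) - (A_i^T y_i)_r <= 0].  Every
    function involved is a convex polynomial along each line, and the equations
    [A_i w_i = w_i^0 b_i] of the relaxation say exactly that the Lagrangian of
    the lifted problem does not depend on [y].

    Attainment.  A finite system of convex polynomial inequalities that can be
    solved up to every positive error can be solved exactly
    ([convex_polynomial_system_closed]).  If the relaxed solution sets are
    bounded this is compactness; otherwise they have a common recession
    direction, along which a convex polynomial bounded above is affine.  If all
    slopes vanish one variable can be eliminated; if some slope is negative the
    corresponding inequalities can be satisfied at the end by moving far along
    the direction, so they can be dropped.  Applied to the constraints together
    with [f - inf f <= 0], this gives a minimiser.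

    Linear duality.  The same closedness and the alternative theorem for strict
    convex inequalities ([convex_alternative], itself an induction on the number
    of functions using only convexity) give the Farkas lemmas
    [robust_farkas] and [robust_farkas_strict].

    Strong duality.  The alternative theorem applied to the lifted problem gives
    multipliers [w] for which [sigma = f + sum w g - min f] is nonnegative; the
    Slater point makes the multiplier of [f] positive.  The polynomial [sigma] is
    SOS-convex and vanishes at the minimiser, so its gradient vanishes there too.
    Taylor's formula with integral remainder writes [sigma] as the integral over
    [0 <= s <= 1] of [1 - s] times the second derivative along the segment from
    the minimiser, a sum of squares depending polynomially on [s]; the moment
    matrix of the weight [1 - s] is positive semidefinite, hence a sum of rank-one
    matrices, so the integral is itself a sum of squares
    ([sos_convex_critical_zero_sos]).  The degree of [sigma] is at most that of the data,
    which makes [min f] feasible for the relaxation; weak duality is evaluation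
    at a feasible point. *)

(** * Univariate polynomials with nonnegative second derivative *)

Lemma deriv2_ge0_tangent (R : rcfType) (P : {poly R}) (x y : R) :
  (forall t, 0 <= P^`()^`().[t]) -> P.[x] + P^`().[x] * (y - x) <= P.[y].
Proof.
move=> P2; have [xy|yx|->] := ltgtP x y; last by rewrite subrr mulr0 addr0.
- have [c] := poly_mvt P xy; rewrite in_itv /= => /andP[xc _] eP.
  have [d _ eD] := poly_mvt P^`() xc.
  have : 0 <= P^`().[c] - P^`().[x] by rewrite eD mulr_ge0 // subr_ge0 ltW.
  nra.
- have [c] := poly_mvt P yx; rewrite in_itv /= => /andP[_ cx] eP.
  have [d _ eD] := poly_mvt P^`() cx.
  have : 0 <= P^`().[x] - P^`().[c] by rewrite eD mulr_ge0 // subr_ge0 ltW.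
  nra.
Qed.

Lemma deriv2_ge0_convex (R : rcfType) (P : {poly R}) (s : R) :
  (forall t, 0 <= P^`()^`().[t]) -> 0 <= s -> s <= 1 ->
  P.[s] <= (1 - s) * P.[0] + s * P.[1].
Proof.
move=> P2 s0 s1.
have := deriv2_ge0_tangent s 0 P2; have := deriv2_ge0_tangent s 1 P2.
nra.
Qed.

(** If [Q] were not constant, [Q ^+ 2 - B ^+ 2] would have positive leading
    coefficient and so be positive far out, against the bound. *)
Lemma bounded_poly_const (R : rcfType) (Q : {poly R}) (B : R) :
  (forall t, 0 <= t -> `|Q.[t]| <= B) -> exists c, Q = c%:P.
Proof.
move=> QB; have [le1|gt1] := leqP (size Q) 1.
  by exists Q`_0; exact: size1_polyC.
pose P := Q ^+ 2 - (B ^+ 2)%:P.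
have Q0 : Q != 0 by apply: contraTneq gt1 => ->; rewrite size_poly0.
have szQ2 : (1 < size (Q ^+ 2)%R)%N.
  by rewrite expr2 size_mul //; move: gt1; case: (size Q) => [|[|k]] // _; rewrite !addnS.
have lcP : 0 < lead_coef P.
  rewrite /P lead_coefDl; last first.
    by rewrite size_polyN (leq_ltn_trans (size_polyC_leq1 _)).
  by rewrite lead_coef_exp exprn_even_gt0 //= lead_coef_eq0.
have [n nP] := poly_pinfty_gt_lc lcP.
have := nP (Num.max n 0); rewrite le_max lexx => /(_ isT).
set t := Num.max n 0; have t0 : 0 <= t by rewrite le_max lexx orbT.
rewrite hornerD hornerN hornerC horner_exp => /(lt_le_trans lcP).
have := QB t t0; have := normr_ge0 Q.[t].
by rewrite -[Q.[t] ^+ 2]real_normK ?num_real //; nra.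
Qed.

(** The derivative is nondecreasing, and nonpositive because a positive slope would
    carry the tangent above [B].  Being thus bounded on the half-line it is
    constant.  This is where convex polynomials differ from convex functions such
    as [exp (- t)]. *)
Lemma deriv2_ge0_bounded_affine (R : rcfType) (P : {poly R}) (B : R) :
  (forall t, 0 <= P^`()^`().[t]) -> (forall t, 0 <= t -> P.[t] <= B) ->
  exists2 c, c <= 0 & forall t, P.[t] = P.[0] + t * c.
Proof.
move=> P2 PB.
have P'mono s t : s <= t -> P^`().[s] <= P^`().[t].
  rewrite le_eqVlt => /orP[/eqP->//|st].
  have [d _ eD] := poly_mvt P^`() st.
  by rewrite -subr_ge0 eD mulr_ge0 // subr_ge0 ltW.
have P'le0 s : 0 <= s -> P^`().[s] <= 0.
  move=> s0; rewrite leNgt; apply/negP => P's.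
  (* the tangent at [s] reaches [B + 1] there *)
  pose t := s + (B - P.[s] + 1) / P^`().[s].
  have eqt : P^`().[s] * (t - s) = B - P.[s] + 1.
    by rewrite /t addrAC subrr add0r mulrC divfK // gt_eqF.
  have t0 : 0 <= t.
    rewrite /t addr_ge0 // divr_ge0 ?ltW // ltr_wpDl // subr_ge0.
    exact: PB.
  have := deriv2_ge0_tangent s t P2; rewrite eqt.
  have := PB t t0; lra.
have [t t0|c eqc] := @bounded_poly_const R P^`() (- P^`().[0]).
  rewrite ler0_norm ?P'le0 // lerN2; exact: P'mono.
have P'c t : P^`().[t] = c by rewrite eqc hornerC.
exists c; first by rewrite -(P'c 0) P'le0.
move=> t; apply/eqP; rewrite eq_le.
have := deriv2_ge0_tangent 0 t P2; have := deriv2_ge0_tangent t 0 P2.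
by rewrite !P'c; move=> h1 h2; apply/andP; split; lra.
Qed.

(** * Sums of squares and positive semidefinite matrices *)

Definition sum_of_squares (S : nzRingType) (a : S) :=
  exists s : seq S, a = \sum_(h <- s) h ^+ 2.

Lemma sum_of_squares0 (S : nzRingType) : sum_of_squares (0 : S).
Proof. by exists [::]; rewrite big_nil. Qed.

Lemma sum_of_squaresD (S : nzRingType) (a b : S) :
  sum_of_squares a -> sum_of_squares b -> sum_of_squares (a + b).
Proof. by move=> [s ->] [t ->]; exists (s ++ t); rewrite big_cat. Qed.

Lemma sum_of_squares_sum (S : nzRingType) (I : Type) (r : seq I) (F : I -> S) :
  (forall i, sum_of_squares (F i)) -> sum_of_squares (\sum_(i <- r) F i).
Proof.
move=> sF; elim/big_ind: _ => //; first exact: sum_of_squares0.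
exact: sum_of_squaresD.
Qed.

Lemma ge0_affine_slope0 (R : realFieldType) (a b : R) :
  (forall t, 0 <= a + t * b) -> b = 0.
Proof.
move=> ab; apply/eqP; apply: contraT => b0.
have := ab (- (a + 1) / b); rewrite divfK //; lra.
Qed.

(** Cholesky decomposition by completing the square in the first variable: the
    first row divided by the square root of the corner entry gives one vector, and
    the Schur complement is again positive semidefinite. *)
Lemma psd_sum_rank1 (R : rcfType) (K : nat) (G : 'I_K -> 'I_K -> R) :
  (forall i j, G i j = G j i) ->
  (forall u : 'I_K -> R, 0 <= \sum_i \sum_j G i j * (u i * u j)) ->
  exists vs : seq ('I_K -> R), forall i j, G i j = \sum_(v <- vs) v i * v j.
Proof.
elim: K G => [|K IH] G Gsym Gpsd; first by exists [::] => -[].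
pose g j := G ord0 (lift ord0 j).
pose ext t (u : 'I_K -> R) i := oapp u t (unlift ord0 i).
have ext0 t u : ext t u ord0 = t by rewrite /ext unlift_none.
have extS t u j : ext t u (lift ord0 j) = u j by rewrite /ext liftK.
have Gext t (u : 'I_K -> R) :
    0 <= G ord0 ord0 * t ^+ 2 + 2 * t * (\sum_j g j * u j)
       + \sum_i \sum_j G (lift ord0 i) (lift ord0 j) * (u i * u j).
  suff <- : \sum_i \sum_j G i j * (ext t u i * ext t u j) =
    G ord0 ord0 * t ^+ 2 + 2 * t * (\sum_j g j * u j)
    + \sum_i \sum_j G (lift ord0 i) (lift ord0 j) * (u i * u j) by exact: Gpsd.
  rewrite big_ord_recl big_ord_recl /= ext0.
  under [X in _ + X]eq_bigr do rewrite big_ord_recl ext0 extS.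
  rewrite big_split /=.
  under [X in _ + (_ + X) = _]eq_bigr do under eq_bigr do rewrite !extS.
  rewrite [X in _ + X + _ = _](_ : _ = t * \sum_j g j * u j); last first.
    by rewrite mulr_sumr; apply: eq_bigr => j _; rewrite extS /g; ring.
  rewrite [X in _ + (X + _) = _](_ : _ = t * \sum_j g j * u j); last first.
    by rewrite mulr_sumr; apply: eq_bigr => j _; rewrite Gsym /g; ring.
  ring.
have G00 : 0 <= G ord0 ord0.
  have := Gext 1 (fun=> 0); rewrite !big1 => [|i _|i _].
  - by rewrite expr1n; lra.
  - by rewrite big1 // => j _; rewrite !mulr0.
  - by rewrite mulr0.
have g0 : G ord0 ord0 = 0 -> forall j, g j = 0.
  move=> G0 j; pose u k : R := (k == j)%:R.
  have gu : \sum_k g k * u k = g j.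
    rewrite (bigD1 j) //= /u eqxx mulr1 big1 ?addr0 // => k /negbTE ->.
    by rewrite mulr0.
  apply: (@ge0_affine_slope0 _
    (\sum_i \sum_j G (lift ord0 i) (lift ord0 j) * (u i * u j))) => t.
  by have := Gext (t / 2) u; rewrite G0 gu; lra.
(* Schur complement; division by zero gives the right value when the
   corner entry vanishes, because then the whole first row does *)
pose H i j := G (lift ord0 i) (lift ord0 j) - g i * g j / G ord0 ord0.
have Hpsd u : 0 <= \sum_i \sum_j H i j * (u i * u j).
  have -> : \sum_i \sum_j H i j * (u i * u j) =
      \sum_i \sum_j G (lift ord0 i) (lift ord0 j) * (u i * u j)
      - (\sum_j g j * u j) ^+ 2 / G ord0 ord0.
    rewrite expr2 mulr_suml mulr_suml -sumrB.
    apply: eq_bigr => i _; rewrite mulr_sumr mulr_suml -sumrB.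
    by apply: eq_bigr => j _; rewrite /H; ring.
  have [G0|Gn0] := eqVneq (G ord0 ord0) 0.
    by have := Gext 0 u; rewrite G0 invr0; lra.
  have := Gext (- (\sum_j g j * u j) / G ord0 ord0) u.
  set S := \sum_j g j * u j.
  set T := \sum_i \sum_j G _ _ * (u i * u j).
  suff -> : G ord0 ord0 * (- S / G ord0 ord0) ^+ 2
            + 2 * (- S / G ord0 ord0) * S + T = T - S ^+ 2 / G ord0 ord0 by [].
  by field.
have [i j|//|vs Hvs] := IH H.
  by rewrite /H Gsym [g i * _]mulrC.
pose v0 i := G ord0 i / Num.sqrt (G ord0 ord0).
exists (v0 :: [seq ext 0 v | v <- vs]) => i j; rewrite big_cons big_map.
have v0v0 : v0 i * v0 j = G ord0 i * G ord0 j / G ord0 ord0.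
  rewrite /v0 mulrACA -invfM -expr2 sqr_sqrtr //.
rewrite v0v0.
have [i'|] := unliftP ord0 i; have [j'|] := unliftP ord0 j => -> ->.
- under eq_bigr do rewrite !extS.
  by rewrite -Hvs /H /g; ring.
- under eq_bigr do rewrite ext0 mulr0.
  rewrite big1 // addr0 Gsym; have [G0|Gn0] := eqVneq (G ord0 ord0) 0.
    by have := g0 G0 i'; rewrite /g => ->; rewrite !mul0r.
  by rewrite mulfK.
- under eq_bigr do rewrite ext0 mul0r.
  rewrite big1 // addr0; have [G0|Gn0] := eqVneq (G ord0 ord0) 0.
    by have := g0 G0 j'; rewrite /g => ->; rewrite !(mul0r, mulr0).
  by rewrite mulrC mulKf.
- under eq_bigr do rewrite ext0 mul0r.
  rewrite big1 // addr0; have [G0|Gn0] := eqVneq (G ord0 ord0) 0.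
    by rewrite G0 !mul0r.
  by rewrite mulfK.
Qed.

(** * Taylor remainders and nonnegative SOS-convex polynomials *)

(** [moment R i] is the integral of [(1 - s) * s ^+ i] over [0 <= s <= 1]. *)
Definition moment (R : fieldType) (i : nat) : R := (i.+1%:R * i.+2%:R)^-1.

(** Taylor's formula at order two with its integral remainder, the integral being
    computed coefficient by coefficient so that it makes sense over any
    commutative algebra. *)
Lemma taylor2_at1 (R : numFieldType) (S : comAlgType R) (Q : {poly S}) (N : nat) :
  (size Q <= N)%N ->
  Q.[1] = Q.[0] + Q^`().[0] + \sum_(i < N) moment R i *: Q^`()^`()`_i.
Proof.
move=> szQ; have szQ2 : (size Q <= N.+2)%N by apply: leqW; exact: leqW.
rewrite (horner_coef_wide _ szQ2) 2!big_ord_recl !expr1n !mulr1 addrA.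
rewrite !horner_coef0 coef_deriv mulr1n /=; congr (_ + _).
apply: eq_bigr => i _; rewrite expr1n mulr1 /bump /= !add1n !coef_deriv.
rewrite -mulrnA -(@scaler_nat R) scalerA /moment -natrM mulnC mulVf ?scale1r //.
by rewrite pnatr_eq0.
Qed.

Lemma antiderivative (R : numFieldType) (p : {poly R}) : exists Q, Q^`() = p.
Proof.
exists (\poly_(i < (size p).+1) (p`_i.-1 / i%:R)); apply/polyP => i.
rewrite coef_deriv coef_poly ltnS; case: ltnP => [_|szp].
  by rewrite -[LHS]mulr_natr mulfVK ?pnatr_eq0.
by rewrite mul0rn nth_default.
Qed.

Lemma moment_square (R : fieldType) (S : comAlgType R) (K N : nat) (u : 'I_K -> S) :
  (K.*2 <= N)%N ->
  \sum_(i < N) moment R i *: ((\sum_(k < K) (u k)%:P * 'X^k) ^+ 2)`_i =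
  \sum_(k < K) \sum_(l < K) moment R (k + l)%N *: (u k * u l).
Proof.
move=> KN; under eq_bigr do rewrite expr2 mulr_suml coef_sum scaler_sumr.
rewrite exchange_big; apply: eq_bigr => k _ /=.
under eq_bigr do rewrite mulr_sumr coef_sum scaler_sumr.
rewrite exchange_big; apply: eq_bigr => l _ /=.
have klN : (k + l < N)%N.
  by apply: leq_trans KN; rewrite -addnn -addnS leq_add // ltnW.
have E : (u k)%:P * 'X^k * ((u l)%:P * 'X^l) = (u k * u l) *: 'X^(k + l).
  by rewrite mulrACA -polyCM -exprD mul_polyC.
rewrite (bigD1 (Ordinal klN)) //= E coefZ coefXn eqxx mulr1 big1 ?addr0 //.
move=> i /negbTE ik; rewrite coefZ coefXn -val_eqE /= in ik *.
by rewrite ik mulr0 scaler0.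
Qed.

(** The form is the integral of [(1 - s) * p(s) ^+ 2] for the real polynomial [p] with
    coefficients [u].  By Taylor's formula it equals [Q(1) - Q(0) - Q'(0)] for a
    double antiderivative [Q] of [p ^+ 2], and [Q] lies above its tangents. *)
Lemma moment_psd (R : rcfType) (K : nat) (u : 'I_K -> R) :
  0 <= \sum_(k < K) \sum_(l < K) moment R (k + l)%N * (u k * u l).
Proof.
set p := \sum_(k < K) (u k)%:P * 'X^k.
have [Q1 Q1E] := antiderivative (p ^+ 2); have [Q QE] := antiderivative Q1.
have szQ : (size Q <= K.*2 + size Q)%N by exact: leq_addl.
have Q2 t : 0 <= Q^`()^`().[t] by rewrite QE Q1E horner_exp sqr_ge0.
rewrite -(@moment_square R R^o K _ u (leq_addr (size Q) _)) -/p -Q1E -QE.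
have := deriv2_ge0_tangent 0 1 Q2.
by rewrite subr0 mulr1 (@taylor2_at1 R R^o Q _ szQ) lerDl.
Qed.

(** Integrating a sum of squares with a positive weight yields a sum of squares: the
    remainder is the moment form evaluated at the coefficients of the [q k], and the
    rank-one decomposition of the moment matrix turns it into squares.  It is used
    with [S] a polynomial ring, the variable of [Q] being the parameter of a
    segment. *)
Lemma taylor2_remainder_sos (R : rcfType) (S : comAlgType R) (Q : {poly S})
    (r : nat) (q : 'I_r -> {poly S}) :
  Q^`()^`() = \sum_(k < r) q k ^+ 2 ->
  sum_of_squares (Q.[1] - Q.[0] - Q^`().[0]).
Proof.
move=> Q2; pose K := \max_(k < r) size (q k).
rewrite (@taylor2_at1 R S Q (K.*2 + size Q)) ?leq_addl //.
rewrite -[_ + _ - _ - _]addrA -opprD [_ + \sum_(i < _) _]addrC addrK Q2.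
under eq_bigr do rewrite coef_sum scaler_sumr.
rewrite exchange_big; apply: sum_of_squares_sum => k /=.
have -> : q k = \sum_(i < K) ((q k)`_i)%:P * 'X^i.
  have szq : (size (q k) <= K)%N by exact: (leq_bigmax k).
  apply/polyP => j; rewrite coef_sum; under eq_bigr do rewrite coefCM coefXn.
  have [jK|Kj] := ltnP j K.
    rewrite (bigD1 (Ordinal jK)) //= eqxx mulr1 big1 ?addr0 // => i.
    by rewrite -val_eqE eq_sym => /negbTE ->; rewrite mulr0.
  rewrite nth_default ?(leq_trans szq) // big1 // => i _.
  by rewrite gtn_eqF ?mulr0 // (leq_trans (ltn_ord i)).
rewrite moment_square ?leq_addr //.
have [i j|u|vs vsE] := @psd_sum_rank1 R K (fun i j => moment R (i + j)).
- by rewrite addnC.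
- exact: moment_psd.
exists [seq \sum_(i < K) v i *: (q k)`_i | v <- vs]; rewrite big_map.
under [LHS]eq_bigr do under eq_bigr do rewrite vsE scaler_suml.
under [LHS]eq_bigr do rewrite exchange_big /=.
rewrite exchange_big /=; apply: eq_bigr => v _.
rewrite expr2 mulr_suml; apply: eq_bigr => i _; rewrite mulr_sumr.
by apply: eq_bigr => j _; rewrite -scalerAl -scalerAr scalerA.
Qed.

(** Chain rule for a polynomial composed with a curve [u].  Both sides are derivations
    along the substitution, so it suffices to check constants and variables. *)
Lemma deriv_mmap_polyC (R : nzRingType) (S : comNzRingType) (n : nat)
    (h : {rmorphism R -> S}) (u : 'I_n -> {poly S}) (p : {mpoly R[n]}) :
  (mmap (polyC \o h) u p)^`() =
  \sum_i mmap (polyC \o h) u p^`M(i) * (u i)^`().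
Proof.
pose D q := (mmap (polyC \o h) u q)^`() =
  \sum_i mmap (polyC \o h) u q^`M(i) * (u i)^`().
rewrite -/(D p).
have DM q1 q2 : D q1 -> D q2 -> D (q1 * q2).
  rewrite /D rmorphM derivM => -> ->.
  under [RHS]eq_bigr do rewrite mderivM rmorphD !rmorphM mulrDl.
  rewrite big_split mulr_suml mulr_sumr /=; congr (_ + _).
    by apply: eq_bigr => i _; rewrite mulrAC.
  by apply: eq_bigr => i _; rewrite mulrA.
have DC c : D c%:MP.
  rewrite /D mmapC derivC big1 // => i _.
  by rewrite mderivC mmap0 mul0r.
have DX k : D 'X_k.
  rewrite /D mmapX mmap1U (bigD1 k) //= big1 ?addr0 => [|i ik].
    rewrite mderivX mnm1E eqxx scale1r.
    have -> : (U_(k) - U_(k) = 0)%MM by apply/mnmP => j; rewrite mnmBE subnn mnm0E.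
    by rewrite mpolyX0 rmorph1 mul1r.
  by rewrite mderivX mnm1E eq_sym (negbTE ik) scale0r mmap0 mul0r.
have DX1 m : D 'X_[m].
  rewrite mpolyXE_id; elim/big_ind: _ => // [|k _]; first exact: (DC 1).
  by elim: (m k) => [|e IHe]; [exact: (DC 1) | rewrite exprS; exact: DM].
elim/mpolyind: p => [|c m q _ _ Dq]; first by rewrite -mpolyC0; exact: DC.
rewrite -mul_mpolyC; have := DM _ _ (DC c) (DX1 m).
rewrite /D in Dq *; rewrite !rmorphD derivD Dq => ->.
by rewrite -big_split; apply: eq_bigr => i _; rewrite mderivD rmorphD mulrDl.
Qed.

Lemma horner_mmap_polyC (R : nzRingType) (S : comNzRingType) (n : nat)
    (h : {rmorphism R -> S}) (u : 'I_n -> {poly S}) (p : {mpoly R[n]}) (t : S) :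
  (mmap (polyC \o h) u p).[t] = mmap h (fun i => (u i).[t]) p.
Proof.
rewrite /mmap horner_sum; apply: eq_bigr => m _.
rewrite hornerM hornerC /mmap1 horner_prod; congr (_ * _).
by apply: eq_bigr => i _; rewrite horner_exp.
Qed.

Lemma deriv2_mmap_polyC_sos (R : realType) (S : comNzRingType) (n r : nat)
    (h : {rmorphism R -> S}) (a c : 'I_n -> S) (p : {mpoly R[n]})
    (H : 'M[{mpoly R[n]}]_(n, r)) :
  hessian p = H *m H^T ->
  let E := mmap (polyC \o h) (fun i => (a i)%:P + (c i)%:P * 'X) in
  (E p)^`()^`() = \sum_(k < r) (\sum_i E (H i k) * (c i)%:P) ^+ 2.
Proof.
move=> hessE E.
have u' i : ((a i)%:P + (c i)%:P * 'X)^`() = (c i)%:P.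
  by rewrite derivD derivM !derivC derivX mul0r mulr1 !add0r.
have E' q : (E q)^`() = \sum_i E q^`M(i) * (c i)%:P.
  by rewrite deriv_mmap_polyC; apply: eq_bigr => i _; rewrite u'.
rewrite E' raddf_sum /=.
have -> : \sum_i (E p^`M(i) * (c i)%:P)^`() =
    \sum_i \sum_j \sum_(k < r) E (H i k) * E (H j k) * (c i)%:P * (c j)%:P.
  apply: eq_bigr => i _; rewrite derivM derivC mulr0 addr0 E' mulr_suml.
  apply: eq_bigr => j _.
  have -> : p^`M(i)^`M(j) = \sum_k H i k * H j k.
    have := congr1 (fun M : matrix _ _ _ => M i j) hessE; rewrite !mxE => ->.
    by apply: eq_bigr => k _; rewrite mxE.
  rewrite /E rmorph_sum !mulr_suml /=; apply: eq_bigr => k _.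
  by rewrite rmorphM mulrAC.
under [LHS]eq_bigr do rewrite exchange_big /=.
rewrite exchange_big /=; apply: eq_bigr => k _.
rewrite expr2 mulr_suml; apply: eq_bigr => i _; rewrite mulr_sumr.
apply: eq_bigr => j _; ring.
Qed.

(** The line from [a] to the generic point of coordinates ['X_i] is parametrised over
    the polynomial ring itself, so that the value at [1] of the resulting univariate
    polynomial is [p]; the value and the derivative at [0] vanish by hypothesis,
    which leaves the Taylor remainder. *)
Theorem sos_convex_critical_zero_sos (R : realType) (n : nat) (p : {mpoly R[n]})
    (a : 'I_n -> R) :
  sos_convex p -> p.@[a] = 0 -> (forall i, p^`M(i).@[a] = 0) ->
  sum_of_squares p.
Proof.
move=> [r [H hessE]] pa0 grad0.
pose u i : {poly {mpoly R[n]}} := ((a i)%:MP_[n])%:P + ('X_i - (a i)%:MP)%:P * 'X.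
have uE t i : (u i).[t] = (a i)%:MP + ('X_i - (a i)%:MP) * t.
  by rewrite hornerD hornerM !hornerC hornerX.
pose E := mmap (polyC \o @mpolyC n R) u.
have at0 q : (E q).[0] = q.@[a]%:MP.
  rewrite horner_mmap_polyC mevalE raddf_sum /=; apply: eq_bigr => m _.
  rewrite mpolyCM rmorph_prod /mmap1; congr (_ * _).
  by apply: eq_bigr => i _; rewrite uE mulr0 addr0 rmorphXn.
have at1 : (E p).[1] = p.
  rewrite horner_mmap_polyC -[RHS]comp_mpoly_id /comp_mpoly.
  apply: eq_bigr => m _; congr (_ * _); apply: mmap1_eq => i.
  by rewrite uE mulr1 addrC subrK tnth_mktuple.
have grad : (E p)^`().[0] = 0.
  rewrite deriv_mmap_polyC horner_sum big1 // => i _.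
  by rewrite hornerM at0 grad0 mpolyC0 mul0r.
have := taylor2_remainder_sos (deriv2_mmap_polyC_sos (@mpolyC n R)
  (fun i => (a i)%:MP) (fun i => 'X_i - (a i)%:MP) hessE).
by rewrite -/u -/E at1 at0 pa0 grad mpolyC0 !subr0.
Qed.

Lemma mpoly_line (R : realType) (n : nat) (p : {mpoly R[n]})
    (x d : 'I_n -> R) : exists P : {poly R},
  [/\ forall t, P.[t] = p.@[fun i => x i + t * d i],
      P^`().[0] = \sum_i p^`M(i).@[x] * d i
    & sos_convex p -> forall t, 0 <= P^`()^`().[t]].
Proof.
pose u i : {poly R} := (x i)%:P + (d i)%:P * 'X.
have uE t i : (u i).[t] = x i + t * d i.
  by rewrite hornerD hornerM !hornerC hornerX mulrC.
pose E := mmap (polyC \o idfun) u.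
have eE q t : (E q).[t] = q.@[fun i => x i + t * d i].
  rewrite horner_mmap_polyC /meval; apply: eq_bigr => m _; congr (_ * _).
  exact: mmap1_eq.
exists (E p); split=> //.
  rewrite deriv_mmap_polyC horner_sum; apply: eq_bigr => i _.
  rewrite hornerM eE /u derivD derivM !derivC derivX mul0r mulr1 !add0r hornerC.
  by congr (_ * _); apply: meval_eq => j; rewrite mul0r addr0.
move=> [r [H hessE]] t.
rewrite (deriv2_mmap_polyC_sos idfun x d hessE) horner_sum sumr_ge0 // => k _.
by rewrite horner_exp sqr_ge0.
Qed.

(** * Convex polynomials along lines and their recession directions *)

(** Everything that is needed of a convex polynomial, in a form that passes to
    coordinate subspaces and is insensitive to how the variables are indexed. *)
Definition convex_polynomial (R : realType) (n : nat) (p : 'rV[R]_n -> R) :=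
  continuous p /\ forall x d, exists P : {poly R},
    (forall t, p (x + t *: d) = P.[t]) /\ forall t, 0 <= P^`()^`().[t].

Definition convex_function (R : realType) (V : lmodType R) (p : V -> R) :=
  forall (x y : V) (t : R), 0 <= t -> t <= 1 ->
  p ((1 - t) *: x + t *: y) <= (1 - t) * p x + t * p y.

Lemma convex_combE (R : realType) (V : lmodType R) (x y : V) (t : R) :
  (1 - t) *: x + t *: y = x + t *: (y - x).
Proof. by rewrite scalerBl scale1r scalerBr -addrA [- _ + _]addrC. Qed.

Lemma convex_polynomial_convex (R : realType) n (p : 'rV[R]_n -> R) :
  convex_polynomial p -> convex_function p.
Proof.
move=> [_ lp] x y t t0 t1; rewrite convex_combE.
have [P [PE P2]] := lp x (y - x); have := deriv2_ge0_convex P2 t0 t1.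
by rewrite -!PE scale0r scale1r addr0 [x + (y - x)]addrC subrK.
Qed.

Lemma recession_affine (R : realType) n (p : 'rV[R]_n -> R) x d (B : R) :
  convex_polynomial p -> (forall t, 0 <= t -> p (x + t *: d) <= B) ->
  exists2 c, c <= 0 & forall t, p (x + t *: d) = p x + t * c.
Proof.
move=> [_ lp] pB; have [P [PE P2]] := lp x d.
have [t t0|c c0 Pc] := deriv2_ge0_bounded_affine (B := B) P2.
  by rewrite -PE pB.
exists c => // t; rewrite PE Pc -(PE 0) scale0r addr0 //.
Qed.

(** Replaces a limit [s -> 0] in inequalities that are affine in [s]. *)
Lemma le0_affine_at0 (R : realFieldType) (a b : R) :
  (forall s, 0 < s -> s <= 1 -> a <= s * b) -> a <= 0.
Proof.
move=> ab; rewrite leNgt; apply/negP => a0.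
have b0 : 0 < b by have := ab 1 ltr01 (lexx _); lra.
have ab1 : a <= b by have := ab 1 ltr01 (lexx _); lra.
have := ab (a / (2 * b)); rewrite divr_gt0 ?mulr_gt0 // => /(_ isT).
have -> : a / (2 * b) * b = a / 2 by field; lra.
have -> : a / (2 * b) <= 1 by rewrite ler_pdivrMr ?mulr_gt0 //; lra.
by move=> /(_ isT); lra.
Qed.

(** The point [y + t *: d] is the limit, as [s] tends to [0], of the convex
    combinations of [y] and of the remote point [x + (t / s) *: d]. *)
Lemma recession_le (R : realType) n (p : 'rV[R]_n -> R) x y d (c : R) :
  convex_polynomial p -> (forall t, p (x + t *: d) = p x + t * c) ->
  forall t, 0 <= t -> p (y + t *: d) <= p y + t * c.
Proof.
move=> cp pc t t0; rewrite -subr_le0.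
have [P [PE P2]] := cp.2 (y + t *: d) (x - y).
apply: (@le0_affine_at0 _ _ (p x - p y - P^`().[0])) => s s0 s1.
have Es : y + t *: d + s *: (x - y) =
    (1 - s) *: y + s *: (x + (t / s) *: d).
  rewrite [s *: (x + _ *: d)]scalerDr scalerA [s * _]mulrC divfK ?gt_eqF //.
  by rewrite addrA convex_combE addrAC.
have := convex_polynomial_convex cp y (x + (t / s) *: d) (ltW s0) s1.
rewrite -Es pc PE; have -> : s * (p x + t / s * c) = s * p x + t * c.
  by field; rewrite gt_eqF.
have := deriv2_ge0_tangent 0 s P2; rewrite -!PE scale0r addr0 subr0; lra.
Qed.

(** By [recession_le] the function is bounded above along [d] from [y], hence affine
    there; comparing slopes in both directions shows that they agree. *)
Lemma recession_everywhere (R : realType) n (p : 'rV[R]_n -> R) x y d (c : R) :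
  convex_polynomial p -> c <= 0 -> (forall t, p (x + t *: d) = p x + t * c) ->
  forall t, p (y + t *: d) = p y + t * c.
Proof.
move=> cp c0 px; have le_y := recession_le y cp px.
have [t t0|c' c'0 py] := @recession_affine _ _ p y d (p y) cp.
  by apply: le_trans (le_y t t0) _; rewrite gerDl mulr_ge0_le0.
have := recession_le x cp py ler01; have := le_y 1 ler01.
by rewrite px py !mul1r => h1 h2; have <- : c' = c by lra.
Qed.

Lemma closed_sublevel (R : realType) (T : topologicalType) (p : T -> R) (e : R) :
  continuous p -> closed [set x | p x <= e].
Proof.
move=> cp; have -> : [set x | p x <= e] = p @^-1` [set z | z <= e] by [].
by apply: closed_comp => [x _|]; [exact: cp | exact: closed_le].
Qed.

Lemma closed_superlevel (R : realType) (T : topologicalType) (p : T -> R)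
    (e : R) : continuous p -> closed [set x | e <= p x].
Proof.
move=> cp; have -> : [set x | e <= p x] = p @^-1` [set z | e <= z] by [].
by apply: closed_comp => [x _|]; [exact: cp | exact: closed_ge].
Qed.

(** Sequential compactness in the form used below: a cluster point belongs to every
    closed set that eventually contains the sequence. *)
Lemma bounded_seq_cluster (R : realType) n (u : nat -> 'rV[R]_n) (M : R) :
  (forall k, `|u k| <= M) ->
  exists z, forall C : set 'rV[R]_n,
    closed C -> (\forall k \near \oo, C (u k)) -> C z.
Proof.
move=> uM; have cK : compact [set z : 'rV[R]_n | `|z| <= M].
  apply: bounded_closed_compact; last exact/closed_sublevel/norm_continuous.
  by exists M; split; [exact: num_real | move=> N MN z /= /le_trans; apply; exact: ltW].
have [|z [_ clz]] := cK (u @ \oo) _; first by exists 0%N => // k _; exact: uM.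
exists z => C clC Cu; apply: clC => B Bz; exact: clz.
Qed.

Lemma insert0_continuous (R : realType) n (j : 'I_n.+1) :
  continuous (fun y : 'rV[R]_n => \row_k oapp (y ord0) 0 (unlift j k)).
Proof.
move=> u A /nbhs_ballP[e /= e0 eA].
apply/nbhs_ballP; exists e => //= v [_ uv]; apply: eA; split => // a b.
rewrite !mxE; case: unliftP => [k _|_] /=; last exact: ballxx.
exact: uv.
Qed.

Lemma convex_polynomial_insert0 (R : realType) n (j : 'I_n.+1)
    (p : 'rV[R]_n.+1 -> R) : convex_polynomial p ->
  convex_polynomial (fun y : 'rV[R]_n => p (\row_k oapp (y ord0) 0 (unlift j k))).
Proof.
move=> [contp lp]; split=> [y|x d].
  by apply: continuous_comp; [exact: insert0_continuous | exact: contp].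
have [P [PE P2]] := lp (\row_k oapp (x ord0) 0 (unlift j k))
                       (\row_k oapp (d ord0) 0 (unlift j k)).
exists P; split=> // t; rewrite -PE; congr p; apply/rowP => k; rewrite !mxE.
by case: unliftP => [k' _|_]; rewrite /= ?mxE // mulr0 addr0.
Qed.

Lemma affine_continuous (R : realType) (V : normedModType R) (x : V) (t : R) :
  continuous (fun z : V => x + t *: z).
Proof.
by move=> z; apply: continuousD; [exact: cst_continuous | exact: scaler_continuous].
Qed.

(** The direction is a cluster point of the unit vectors pointing from a solution to
    solutions tending to infinity.  Convexity keeps each [p i] below [1] on the
    segments, and closedness passes this on to the limiting half-line. *)
Lemma common_recession (R : realType) n (T : eqType) (s : seq T)
    (p : T -> 'rV[R]_n -> R) :
  (forall i, i \in s -> convex_polynomial (p i)) ->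
  (exists x, forall i, i \in s -> p i x <= 1) ->
  (forall M, exists x, (forall i, i \in s -> p i x <= 1) /\ M < `|x|) ->
  exists d, d != 0 /\ forall i, i \in s -> exists2 c, c <= 0 &
    forall x t, p i (x + t *: d) = p i x + t * c.
Proof.
move=> cp [x0 x0P] unb.
have [u uP] := choice (fun k : nat => unb (k%:R + `|x0|)).
have far k : k%:R < `|u k - x0|.
  have := (uP k).2; have := ler_normD (u k - x0) x0; rewrite subrK; lra.
have far0 k : 0 < `|u k - x0| by apply: le_lt_trans (far k).
pose v k := `|u k - x0|^-1 *: (u k - x0).
have v1 k : `|v k| = 1 by rewrite normrZ normfV normr_id mulVf ?gt_eqF.
have [|d dP] := @bounded_seq_cluster R n v 1; first by move=> k; rewrite v1.
exists d; split.
  have : 1 <= `|d|.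
    apply: (dP [set z | 1 <= `|z|]); last by exists 0%N => // k _ /=; rewrite v1.
    exact/closed_superlevel/norm_continuous.
  by apply: contraTneq => ->; rewrite normr0 -ltNge ltr01.
move=> i si; have pd t : 0 <= t -> p i (x0 + t *: d) <= 1.
  move=> t0; apply: (dP [set z | p i (x0 + t *: z) <= 1]).
    apply: closed_sublevel => z.
    apply: continuous_comp; last exact: (cp i si).1.
    exact: affine_continuous.
  exists (Num.bound t) => // k /= tk; rewrite /v scalerA -convex_combE.
  have tfar : t <= `|u k - x0|.
    apply/ltW/(lt_trans (archi_boundP t0))/(le_lt_trans _ (far k)).
    by rewrite ler_nat.
  have s0 : 0 <= t / `|u k - x0| by rewrite divr_ge0.
  have s1 : t / `|u k - x0| <= 1 by rewrite ler_pdivrMr ?mul1r.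
  have := convex_polynomial_convex (cp i si) x0 (u k) s0 s1.
  have := x0P i si; have := (uP k).1 i si; nra.
have [c c0 pc] := recession_affine (cp i si) pd.
by exists c => // x t; apply: recession_everywhere pc t; first exact: cp.
Qed.

(** * Closedness of convex polynomial systems *)

Lemma bounded_system_solvable (R : realType) n (T : eqType) (s : seq T)
    (p : T -> 'rV[R]_n -> R) (M : R) :
  (forall i, i \in s -> continuous (p i)) ->
  (forall e, 0 < e -> exists x, forall i, i \in s -> p i x <= e) ->
  (forall x, (forall i, i \in s -> p i x <= 1) -> `|x| <= M) ->
  exists x, forall i, i \in s -> p i x <= 0.
Proof.
move=> cp sol bnd.
have [u uP] := choice (fun k : nat => sol k.+1%:R^-1 ltac:(by rewrite invr_gt0)).
have [k|z zP] := @bounded_seq_cluster R n u M.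
  apply: bnd => i si; apply: le_trans (uP k i si) _.
  by rewrite invf_le1 // ler1n.
exists z => i si; rewrite leNgt; apply/negP => pz.
have : p i z <= p i z / 2.
  apply: (zP [set z' | p i z' <= p i z / 2]); first exact/closed_sublevel/cp.
  exists (Num.bound (2 / p i z)) => // k /= kN; apply: le_trans (uP k i si) _.
  have kp : 2 / p i z < k.+1%:R.
    apply: lt_le_trans (archi_boundP _) _; first by rewrite divr_ge0 ?ltW.
    by rewrite ler_nat ltnW.
  rewrite -[leRHS]invf_div lef_pV2 ?posrE ?divr_gt0 //; exact: ltW.
lra.
Qed.

(** One step [t] along a recession direction repairs all the inequalities whose slope
    is negative without spoiling the others. *)
Lemma common_shift (R : realFieldType) (T : eqType) (s : seq T) (a c : T -> R) :
  (forall i, i \in s -> c i < 0 \/ (c i = 0 /\ a i <= 0)) ->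
  exists2 t, 0 <= t & forall i, i \in s -> a i + t * c i <= 0.
Proof.
elim: s => [|j s IH] ac; first by exists 0.
have [|t t0 tP] := IH; first by move=> i si; apply: ac; rewrite in_cons si orbT.
have c0 i : i \in s -> c i <= 0.
  by move=> si; have [|//|[->]] := ac i; rewrite ?in_cons ?si ?orbT // => /ltW.
have [cj|[cj aj]] := ac j (mem_head _ _); last first.
  exists t => // i; rewrite in_cons => /predU1P[->|/tP//].
  by rewrite cj mulr0 addr0.
exists (t + `|a j| / (- c j)) => [|i].
  by rewrite addr_ge0 // divr_ge0 // oppr_ge0 ltW.
have q0 : 0 <= `|a j| / (- c j) by rewrite divr_ge0 // oppr_ge0 ltW.
rewrite in_cons => /predU1P[->|si].
  have -> : (t + `|a j| / - c j) * c j = t * c j - `|a j|.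
    by field; rewrite lt_eqF.
  have := ler_norm (a j); have := mulr_ge0_le0 t0 (ltW cj); lra.
have := tP i si; have := mulr_ge0_le0 q0 (c0 i si); lra.
Qed.

(** Induction on the number of variables plus the number of inequalities, following
    the dichotomy on the slopes along a common recession direction. *)
Theorem convex_polynomial_system_closed (R : realType) n (T : eqType)
    (s : seq T) (p : T -> 'rV[R]_n -> R) :
  (forall i, i \in s -> convex_polynomial (p i)) ->
  (forall e, 0 < e -> exists x, forall i, i \in s -> p i x <= e) ->
  exists x, forall i, i \in s -> p i x <= 0.
Proof.
have [N] := ubnP (n + size s); elim: N => // N IH in n s p *.
rewrite ltnS => leN cp sol.
have [[M bnd]|unb] := pselect (exists M,
    forall x, (forall i, i \in s -> p i x <= 1) -> `|x| <= M).
  apply: bounded_system_solvable sol bnd => i si; exact: (cp i si).1.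
have {}unb M : exists x, (forall i, i \in s -> p i x <= 1) /\ M < `|x|.
  apply: contrapT => noM; apply: unb; exists M => x xs.
  by rewrite leNgt; apply/negP => Mx; apply: noM; exists x.
have [d [d0 dP]] := common_recession cp (sol 1 ltr01) unb.
pose c i := p i d - p i 0.
have dE i x t : i \in s -> p i (x + t *: d) = p i x + t * c i.
  move=> si; have [a _ aE] := dP i si; rewrite aE /c.
  by have := aE 0 1; rewrite add0r scale1r mul1r => ->; rewrite [_ + a]addrC addrK.
have c0 i : i \in s -> c i <= 0.
  move=> si; have [a a0 aE] := dP i si; rewrite /c.
  by have := aE 0 1; rewrite add0r scale1r mul1r => ->; rewrite [_ + a]addrC addrK.
have [allc|/allPn[j js cj]] := boolP (all (fun i => c i == 0) s); last first.
  (* some slope is negative: keep the other inequalities only *)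
  pose s' := [seq i <- s | c i == 0].
  have [|i|e e0|x xP] := IH n s' p.
  - apply: leq_trans leN; rewrite -addnS leq_add2l size_filter.
    by rewrite ltn_neqAle count_size andbT -all_count; apply/allPn; exists j.
  - by rewrite mem_filter => /andP[_]; exact: cp.
  - have [x xP] := sol e e0; exists x => i; rewrite mem_filter => /andP[_].
    exact: xP.
  have [i si|t t0 tP] := @common_shift R T s (fun i => p i x) c.
    have [ci|ci] := eqVneq (c i) 0.
      by right; split=> //; apply: xP; rewrite mem_filter ci eqxx.
    by left; rewrite lt_neqAle ci c0.
  by exists (x + t *: d) => i si; rewrite dE // tP.
(* all slopes vanish: translate along [d] until coordinate [j] is zero *)
have [j dj] : exists j, d ord0 j != 0.
  apply: contrapT => alld; move/eqP: d0; apply; apply/rowP => j; rewrite mxE.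
  by apply/eqP; apply: contrapT => dj; apply: alld; exists j; exact/negP.
case: n => [|n] in p cp sol unb d d0 dP c dE c0 allc j dj leN *.
  by have := ltn_ord j.
have [|i si|e e0|y yP] := IH n s
    (fun i (y : 'rV[R]_n) => p i (\row_k oapp (y ord0) 0 (unlift j k))).
- by rewrite -addSn.
- exact/convex_polynomial_insert0/cp.
- have [x xP] := sol e e0.
  exists (\row_k (x - (x ord0 j / d ord0 j) *: d) ord0 (lift j k)) => i si.
  have -> : \row_k oapp ((\row_k0 (x - (x ord0 j / d ord0 j) *: d) ord0
      (lift j k0)) ord0) 0 (unlift j k) = x + (- (x ord0 j / d ord0 j)) *: d.
    apply/rowP => k; rewrite !mxE; case: unliftP => [k' ->|->] /=.
      by rewrite !mxE mulNr.
    by rewrite mulNr divfK // subrr.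
  by rewrite dE // (eqP (allP allc i si)) mulr0 addr0 xP.
by exists (\row_k oapp (y ord0) 0 (unlift j k)).
Qed.

(** * A theorem of the alternative for convex functions *)

Lemma convex_function_sum (R : realType) (V : lmodType R) (T : eqType) (s : seq T)
    (p : T -> V -> R) (w : T -> R) :
  (forall i, i \in s -> 0 <= w i) -> (forall i, i \in s -> convex_function (p i)) ->
  convex_function (fun x => \sum_(i <- s) w i * p i x).
Proof.
move=> w0 cp x y t t0 t1; rewrite !mulr_sumr -big_split /=.
rewrite big_seq [leRHS]big_seq; apply: ler_sum => i si.
by have := ler_wpM2l (w0 i si) (cp i si x y t t0 t1); lra.
Qed.

(** If [q] is nonnegative wherever [r] is negative, then [q + t * r] is nonnegative for
    a suitable [t].  The points with [r < 0] bound [t] from above and those with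
    [r > 0] bound it from below; the bounds are compatible because the segment
    joining two such points meets [r <= 0], where [q] is nonnegative.  Hence the
    infimum of the upper bounds is a valid choice. *)
Section TwoFunctions.
Variables (R : realType) (V : lmodType R) (C : set V) (q r : V -> R) (y0 : V).
Hypothesis convC : forall x y t, C x -> C y -> 0 <= t -> t <= 1 ->
  C ((1 - t) *: x + t *: y).
Hypotheses (convq : convex_function q) (convr : convex_function r).
Hypotheses (Cy0 : C y0) (ry0 : r y0 < 0).
Hypothesis q_ge0 : forall x, C x -> r x < 0 -> 0 <= q x.

Let q_ge0_weak x : C x -> r x <= 0 -> 0 <= q x.
Proof.
move=> Cx rx; rewrite -oppr_le0; apply: (@le0_affine_at0 _ _ (q y0 - q x)).
move=> s s0 s1; have := convq x y0 (ltW s0) s1; have := convr x y0 (ltW s0) s1.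
set z := _ + _ => rz qz; suff : 0 <= q z by lra.
apply: q_ge0; first exact: convC (ltW s0) s1.
have : s * r y0 < 0 by rewrite pmulr_rlt0.
have : (1 - s) * r x <= 0 by rewrite mulr_ge0_le0 // subr_ge0.
lra.
Qed.

Lemma two_function_alternative :
  exists2 t, 0 <= t & forall x, C x -> 0 <= q x + t * r x.
Proof.
pose D := [set d | exists y, [/\ C y, r y < 0 & d = q y / - r y]].
have D0 : D !=set0 by exists (q y0 / - r y0); exists y0.
have lbD x : C x -> 0 < r x -> lbound D (- q x / r x).
  move=> Cx rx _ [y [Cy ry ->]].
  have s0 : 0 <= r x / (r x - r y) by rewrite divr_ge0 //; lra.
  have s1 : r x / (r x - r y) <= 1 by rewrite ler_pdivrMr; lra.
  have := convq x y s0 s1; have := convr x y s0 s1; set z := _ + _ => rz qz.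
  have rz0 : r z <= 0 by apply: le_trans rz _; rewrite le_eqVlt; apply/orP; left;
    apply/eqP; field; lra.
  have := le_trans (q_ge0_weak (convC Cx Cy s0 s1) rz0) qz.
  have -> : (1 - r x / (r x - r y)) * q x + r x / (r x - r y) * q y =
    (- r y * q x + r x * q y) / (r x - r y) by field; lra.
  rewrite pmulr_lge0 ?invr_gt0; last lra.
  by move=> h; rewrite ler_pdivrMr // mulrAC ler_pdivlMr; lra.
have D0lb : lbound D 0 by move=> _ [y [Cy ry ->]]; rewrite divr_ge0 ?q_ge0 //; lra.
exists (inf D) => [|x Cx]; first exact: lb_le_inf.
have [rx|rx|rx] := ltgtP (r x) 0.
- have : inf D <= q x / - r x by apply: ge_inf; [exists 0 | exists x].
  rewrite ler_pdivlMr; lra.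
- have : - q x / r x <= inf D by apply: lb_le_inf => //; exact: lbD.
  rewrite ler_pdivrMr //; lra.
- by rewrite rx mulr0 addr0 q_ge0_weak ?rx.
Qed.

End TwoFunctions.

(** Induction on the number of functions.  The last function [p j] restricts the domain to
    [p j x < 0]; there the others have a nonnegative combination, to which
    [two_function_alternative] adds the right multiple of [p j]. *)
Lemma convex_alternative (R : realType) (V : lmodType R) (T : eqType) (s : seq T)
    (p : T -> V -> R) (C : set V) :
  uniq s -> (forall i, i \in s -> convex_function (p i)) -> C !=set0 ->
  (forall x y t, C x -> C y -> 0 <= t -> t <= 1 -> C ((1 - t) *: x + t *: y)) ->
  ~ (exists2 x, C x & forall i, i \in s -> p i x < 0) ->
  exists w : T -> R, [/\ forall i, 0 <= w i, exists2 i, i \in s & 0 < w i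
    & forall x, C x -> 0 <= \sum_(i <- s) w i * p i x].
Proof.
elim: s C => [|j s IH] C; first by move=> _ _ [x Cx] _ []; exists x.
move=> /= /andP[js us] cp C0 convC noneg.
have cps i : i \in s -> convex_function (p i).
  by move=> si; apply: cp; rewrite in_cons si orbT.
have cpj : convex_function (p j) by exact/cp/mem_head.
pose C' := [set x | C x /\ p j x < 0].
have sumE (w : T -> R) a x :
    \sum_(i <- j :: s) (if i == j then a else w i) * p i x =
    a * p j x + \sum_(i <- s) w i * p i x.
  rewrite big_cons eqxx; congr (_ + _); apply: eq_big_seq => i si.
  by case: eqP => // ij; rewrite -ij si in js.
have [C'0|C'0] := pselect (C' !=set0); last first.
  exists (fun i => if i == j then 1 else 0); split=> [i||x Cx].
  - by case: ifP.
  - by exists j; rewrite ?mem_head ?eqxx.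
  - rewrite (sumE (fun=> 0)) mul1r big1 ?addr0 => [|i _]; last by rewrite mul0r.
    by rewrite leNgt; apply/negP => pj; apply: C'0; exists x.
have [||w [w0 [i si wi] wP]] := IH C' us cps C'0.
- move=> x y t [Cx px] [Cy py] t0 t1; split; first exact: convC.
  apply: le_lt_trans (cpj x y t t0 t1) _.
  have [->|tn0] := eqVneq t 0; first by rewrite subr0 mul1r mul0r addr0.
  have : t * p j y < 0 by rewrite pmulr_rlt0 // lt_neqAle eq_sym tn0.
  have : (1 - t) * p j x <= 0 by rewrite mulr_ge0_le0 // ?subr_ge0 // ltW.
  lra.
- move=> [x [Cx px] xs]; apply: noneg; exists x => // i.
  by rewrite in_cons => /predU1P[->|/xs].
have [y0 [Cy0 py0]] := C'0.
have [t t0 tP] := two_function_alternative convC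
  (convex_function_sum (fun i _ => w0 i) cps) cpj Cy0 py0
  (fun x Cx px => wP x (conj Cx px)).
exists (fun i => if i == j then t else w i); split=> [k||x Cx].
- by case: ifP.
- exists i; first by rewrite in_cons si orbT.
  by case: eqP => // ij; rewrite -ij si in js.
- by rewrite sumE addrC tP.
Qed.

(** * Building convex polynomials *)

Lemma convex_polynomialD (R : realType) n (p1 p2 : 'rV[R]_n -> R) :
  convex_polynomial p1 -> convex_polynomial p2 ->
  convex_polynomial (fun x => p1 x + p2 x).
Proof.
move=> [c1 l1] [c2 l2]; split=> [x|x d].
  by apply: continuousD; [exact: c1 | exact: c2].
have [P1 [E1 D1]] := l1 x d; have [P2 [E2 D2]] := l2 x d.
exists (P1 + P2); split=> t; first by rewrite hornerD E1 E2.
by rewrite !derivD hornerD addr_ge0.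
Qed.

Lemma sum_continuous (R : realType) (U : topologicalType) (I : Type) (r : seq I)
    (F : I -> U -> R) :
  (forall i, continuous (F i)) -> continuous (fun x => \sum_(i <- r) F i x).
Proof.
move=> cF x; apply: (@continuous_big R I +%R 0 xpredT) => //; first exact: add_continuous.
Qed.

Lemma prod_continuous (R : realType) (U : topologicalType) (I : Type) (r : seq I)
    (F : I -> U -> R) :
  (forall i, continuous (F i)) -> continuous (fun x => \prod_(i <- r) F i x).
Proof.
move=> cF x; apply: (@continuous_big R I *%R 1 xpredT) => //; first exact: mul_continuous.
Qed.

Lemma convex_polynomial_linear (R : realType) n (J : Type) (r : seq J)
    (k : J -> 'I_n) (a : R) (c : J -> R) :
  convex_polynomial (fun z : 'rV[R]_n => a + \sum_(j <- r) z ord0 (k j) * c j).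
Proof.
split=> [|x d].
  move=> z; apply: continuousD; first exact: cst_continuous.
  apply: sum_continuous => j {}z; apply: continuousM.
    exact: coord_continuous.
  exact: cst_continuous.
exists ((a + \sum_(j <- r) x ord0 (k j) * c j)%:P
        + (\sum_(j <- r) d ord0 (k j) * c j)%:P * 'X); split=> t.
  rewrite hornerD hornerM !hornerC hornerX -addrA mulr_suml -big_split /=.
  by congr (_ + _); apply: eq_bigr => j _; rewrite !mxE; ring.
by rewrite derivD derivM !derivC derivX mul0r mulr1 !add0r derivC horner0.
Qed.

Lemma convex_polynomial_meval (R : realType) n N (f : {mpoly R[n]})
    (k : 'I_n -> 'I_N) : sos_convex f ->
  convex_polynomial (fun z : 'rV[R]_N => f.@[fun i => z ord0 (k i)]).
Proof.
move=> sf; split=> [|x d].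
  have -> : (fun z : 'rV[R]_N => f.@[fun i => z ord0 (k i)]) = (fun z =>
      \sum_(m <- msupp f) f@_m * \prod_i z ord0 (k i) ^+ m i).
    by apply/funext => z; rewrite mevalE.
  apply: sum_continuous => m z; apply: continuousM; first exact: cst_continuous.
  apply: prod_continuous => i {}z.
  elim: (m i) => [|e IHe]; first exact: cst_continuous.
  have -> : (fun z : 'rV[R]_N => z ord0 (k i) ^+ e.+1) =
    (fun z : 'rV[R]_N => z ord0 (k i) * z ord0 (k i) ^+ e).
    by apply/funext => y; rewrite exprS.
  apply: (@continuousM R _ (fun z : 'rV[R]_N => z ord0 (k i))) IHe.
  exact: coord_continuous.
have [P [PE _ P2]] := mpoly_line f (fun i => x ord0 (k i)) (fun i => d ord0 (k i)).
exists P; split; last exact: P2.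
by move=> t; rewrite PE; apply: meval_eq => i; rewrite !mxE.
Qed.

(** * Linear programming duality for one robust constraint *)

(** Coefficient of the dual variable [y j] in the lifted constraint number [r], namely
    [b j] for the fixed term and [- A j r] for the others. *)
Definition dual_slope (R : realType) (l q : nat) (A : 'M[R]_(l, q)) (b : 'cV[R]_l)
    (r : 'I_q.+1) (j : 'I_l) : R :=
  oapp (fun r' => - A j r') (b j ord0) (unlift ord0 r).

(** Homogenisation of the uncertainty set: [v] is uncertain exactly when [(1, v)] belongs
    to this cone. *)
Definition multiplier_cone (R : realType) (l q : nat) (A : 'M[R]_(l, q))
    (b : 'cV[R]_l) (w : 'I_q.+1 -> R) :=
  (forall r, 0 <= w r) /\
  forall j, \sum_(r < q) A j r * w (lift ord0 r) = w ord0 * b j ord0.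

(** Membership in the cone means that the combined constraint is free of the dual
    variables. *)
Lemma multiplier_coneE (R : realType) (l q : nat) (A : 'M[R]_(l, q))
    (b : 'cV[R]_l) (w : 'I_q.+1 -> R) (j : 'I_l) :
  \sum_r w r * dual_slope A b r j =
  w ord0 * b j ord0 - \sum_(r < q) A j r * w (lift ord0 r).
Proof.
rewrite big_ord_recl {1}/dual_slope unlift_none /= -sumrN; congr (_ + _).
by apply: eq_bigr => r _; rewrite /dual_slope liftK /= mulrN mulrC.
Qed.

Section RobustConstraint.
Variables (R : realType) (l q : nat) (A : 'M[R]_(l, q)) (b : 'cV[R]_l).
Variables (a : 'I_q.+1 -> R).
Hypothesis V0 : uncertainty A b !=set0.

Let robust (v : 'cV[R]_q) : R := a ord0 + \sum_(r < q) v r ord0 * a (lift ord0 r).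

Lemma uncertainty_recession (w : 'I_q.+1 -> R) (v : 'cV[R]_q) t :
  multiplier_cone A b w -> w ord0 = 0 -> uncertainty A b v -> 0 <= t ->
  uncertainty A b (v + t *: \col_r w (lift ord0 r)).
Proof.
move=> [w0 wA] wz [v0 vA] t0; split=> [r|].
  by rewrite !mxE addr_ge0 ?mulr_ge0.
rewrite mulmxDr vA -scalemxAr -[RHS]addr0; congr (_ + _).
apply/colP => j; rewrite !mxE.
under eq_bigr do rewrite mxE.
by rewrite wA wz mul0r mulr0.
Qed.

Lemma uncertainty_normalized (w : 'I_q.+1 -> R) :
  multiplier_cone A b w -> 0 < w ord0 ->
  uncertainty A b (\col_r (w (lift ord0 r) / w ord0)) /\
  \sum_r w r * a r = w ord0 * robust (\col_r (w (lift ord0 r) / w ord0)).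
Proof.
move=> [w0 wA] wp; split.
  split=> [r|]; first by rewrite mxE divr_ge0.
  apply/colP => j; rewrite mxE; under eq_bigr do rewrite mxE mulrA.
  by rewrite -mulr_suml wA mulrAC mulfV ?gt_eqF ?mul1r.
rewrite big_ord_recl /robust mulrDr mulr_sumr; congr (_ + _).
by apply: eq_bigr => r _; rewrite mxE; field; rewrite gt_eqF.
Qed.

(** A multiplier with positive first entry is a multiple of [(1, v)] with [v] uncertain.
    If the first entry is zero the multiplier is a recession direction of the
    uncertainty set, and the constraint, being affine on a half-line contained in
    that set, cannot grow. *)
Lemma multiplier_cone_le0 (w : 'I_q.+1 -> R) :
  (forall v, uncertainty A b v -> robust v <= 0) ->
  multiplier_cone A b w -> \sum_r w r * a r <= 0.
Proof.
move=> rob cw; have [w0 _] := cw.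
have [wz|wn0] := eqVneq (w ord0) 0; last first.
  have wp : 0 < w ord0 by rewrite lt_neqAle eq_sym wn0 w0.
  have [Vv ->] := uncertainty_normalized cw wp.
  by rewrite mulr_ge0_le0 // rob.
have [v Vv] := V0; rewrite big_ord_recl wz mul0r add0r.
set S := \sum_(i < q) _; rewrite leNgt; apply/negP => S0.
have rv := rob v Vv.
have t0 : 0 <= (1 - robust v) / S by rewrite divr_ge0 ?(ltW S0) //; lra.
have := rob _ (uncertainty_recession cw wz Vv t0).
have -> : robust (v + ((1 - robust v) / S) *: \col_r w (lift ord0 r)) =
    robust v + (1 - robust v) / S * S.
  rewrite /robust -addrA mulr_sumr -big_split /=; congr (_ + _).
  by apply: eq_bigr => r _; rewrite !mxE; ring.
rewrite divfK ?gt_eqF //; lra.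
Qed.

Lemma compact_cone_pointed (w : 'I_q.+1 -> R) :
  compact (uncertainty A b) -> multiplier_cone A b w -> w ord0 = 0 ->
  forall r, w r = 0.
Proof.
move=> cV cw wz r; case: (unliftP ord0 r) => [{}r ->|->//].
have [v Vv] := V0; have [M [_ MP]] := compact_bounded cV.
have vM u : uncertainty A b u -> u r ord0 <= M + 1.
  move=> Vu; apply: le_trans (ler_norm _) _.
  have M1 : M < M + 1 by rewrite ltrDl.
  have /= uM := MP _ M1 u Vu; apply: le_trans uM.
  rewrite [leRHS]/Num.norm /= mx_normrE.
  by apply/bigmax_geP; right => /=; exists (r, ord0).
apply/eqP; rewrite eq_le cw.1 andbT leNgt; apply/negP => wr.
have vr := vM v Vv.
have t0 : 0 <= (M + 2 - v r ord0) / w (lift ord0 r).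
  by rewrite divr_ge0 ?(ltW wr) //; lra.
have := vM _ (uncertainty_recession cw wz Vv t0); rewrite !mxE divfK ?gt_eqF //; lra.
Qed.

Lemma multiplier_cone_lt0 (w : 'I_q.+1 -> R) :
  compact (uncertainty A b) -> (forall v, uncertainty A b v -> robust v < 0) ->
  multiplier_cone A b w -> (exists r, 0 < w r) -> \sum_r w r * a r < 0.
Proof.
move=> cV rob cw [r wr]; have wp : 0 < w ord0.
  rewrite lt_neqAle cw.1 andbT; apply/eqP => /esym wz.
  by rewrite (compact_cone_pointed cV cw wz r) ltxx in wr.
by have [Vv ->] := uncertainty_normalized cw wp; rewrite pmulr_rlt0 // rob.
Qed.

Let dual_form (r : 'I_q.+1) (z : 'rV[R]_l) :=
  a r + \sum_(j < l) z ord0 j * dual_slope A b r j.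

Let dual_formP r : convex_polynomial (dual_form r).
Proof. exact: (convex_polynomial_linear (index_enum _) id). Qed.

Let dual_form_cone (w : 'I_q.+1 -> R) (c : R) :
  (forall r, 0 <= w r) ->
  (forall z, c <= \sum_r w r * dual_form r z) ->
  multiplier_cone A b w /\ c <= \sum_r w r * a r.
Proof.
move=> w0 wP; pose S j := \sum_r w r * dual_slope A b r j.
have sumE z : \sum_r w r * dual_form r z = \sum_r w r * a r + \sum_j z ord0 j * S j.
  rewrite /dual_form; under eq_bigr do rewrite mulrDr mulr_sumr.
  rewrite big_split exchange_big /=; congr (_ + _); apply: eq_bigr => j _.
  by rewrite mulr_sumr; apply: eq_bigr => r _; rewrite mulrCA.
(* for [z = t *: S] the linear part is [t] times the sum of squares of [S] *)
have S0 : \sum_j S j ^+ 2 = 0.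
  apply: (@ge0_affine_slope0 _ (\sum_r w r * a r - c)) => t.
  have := wP (\row_j (t * S j)); rewrite sumE -subr_ge0 addrAC.
  suff -> : \sum_j (\row_j (t * S j)) ord0 j * S j = t * \sum_j S j ^+ 2 by [].
  by rewrite mulr_sumr; apply: eq_bigr => j _; rewrite mxE -mulrA.
have Sj j : S j = 0.
  move/eqP: S0; rewrite psumr_eq0 => [/allP/(_ j)|k _]; last exact: sqr_ge0.
  by rewrite mem_index_enum => /(_ isT); rewrite sqrf_eq0 => /eqP.
split; last first.
  have := wP 0; rewrite sumE; under [X in _ + X]eq_bigr do rewrite Sj mulr0.
  by rewrite big1_eq addr0.
split=> // j; apply/esym/eqP; rewrite -subr_eq0 -multiplier_coneE.
by rewrite -/(S j) Sj.
Qed.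

(** Were there no dual vector, closedness would leave a uniform gap [e], and the
    alternative theorem would produce a multiplier in the cone at which the robust
    constraint is positive. *)
Lemma robust_farkas :
  (forall v, uncertainty A b v -> robust v <= 0) ->
  exists z : 'I_l -> R,
    forall r, a r + \sum_j z j * dual_slope A b r j <= 0.
Proof.
move=> rob; apply: contrapT => noz.
have [e e0 eP] : exists2 e : R, 0 < e & forall z, exists r, e < dual_form r z.
  apply: contrapT => noe; apply: noz.
  have [e e0|z zP] := @convex_polynomial_system_closed R l _ (enum 'I_q.+1)
    dual_form (fun r _ => dual_formP r).
    apply: contrapT => noz; apply: noe; exists e => // z.
    apply: contrapT => nor; apply: noz; exists z => r _.
    by rewrite leNgt; apply/negP => er; apply: nor; exists r.
  by exists (z ord0) => r; apply: zP; rewrite mem_enum.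
have [|||||w [w0 [r _ wr] wP]] := @convex_alternative R 'rV[R]_l _ (enum 'I_q.+1)
  (fun r z => dual_form r z - e) setT.
- exact: enum_uniq.
- move=> r _ x y t t0 t1.
  have := convex_polynomial_convex (dual_formP r) x y t0 t1; lra.
- by exists 0.
- by [].
- move=> [z _ zP]; have [r rP] := eP z.
  by have := zP r (mem_enum _ r); lra.
have [z|cw] := @dual_form_cone w (e * \sum_r w r) w0.
  have := wP z I; rewrite big_enum /=.
  under eq_bigr do rewrite mulrBr; rewrite sumrB -mulr_suml; lra.
have := multiplier_cone_le0 rob cw.
have : 0 < \sum_r w r by rewrite (bigD1 r) //= ltr_pwDl // sumr_ge0.
nra.
Qed.

(** Strictness in all the inequalities, including those that come from [v >= 0], is
    available because the multiplier cone of a compact uncertainty set is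
    pointed. *)
Lemma robust_farkas_strict : compact (uncertainty A b) ->
  (forall v, uncertainty A b v -> robust v < 0) ->
  exists z : 'I_l -> R,
    forall r, a r + \sum_j z j * dual_slope A b r j < 0.
Proof.
move=> cV rob; apply: contrapT => noz.
have [|||||w [w0 [r _ wr] wP]] := @convex_alternative R 'rV[R]_l _ (enum 'I_q.+1)
  dual_form setT.
- exact: enum_uniq.
- move=> r _; exact/convex_polynomial_convex.
- by exists 0.
- by [].
- move=> [z _ zP]; apply: noz; exists (z ord0) => r; apply: zP.
  by rewrite mem_enum.
have [z|cw] := @dual_form_cone w 0 w0.
  by have := wP z I; rewrite big_enum.
rewrite leNgt; apply/negP; rewrite negbK.
by apply: multiplier_cone_lt0 => //; exists r.
Qed.

(** Summing the inequalities with the weights [(1, v)] eliminates [z]. *)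
Lemma robust_farkas_converse (z : 'I_l -> R) :
  (forall r, a r + \sum_j z j * dual_slope A b r j <= 0) ->
  forall v, uncertainty A b v -> robust v <= 0.
Proof.
move=> zP v [v0 vA]; pose w r := oapp (v^~ ord0) 1 (unlift ord0 r).
have w0 r : 0 <= w r by rewrite /w; case: unlift => [r'|] /=.
have wS j : \sum_r w r * dual_slope A b r j = 0.
  rewrite multiplier_coneE /w unlift_none mul1r -vA mxE.
  by under [X in _ - X]eq_bigr do rewrite liftK /=; rewrite subrr.
have : \sum_r w r * (a r + \sum_j z j * dual_slope A b r j) <= 0.
  by rewrite sumr_le0 // => r _; rewrite mulr_ge0_le0.
under eq_bigr do rewrite mulrDr mulr_sumr.
rewrite big_split exchange_big /= [X in _ + X]big1 ?addr0 => [|j _].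
  rewrite big_ord_recl /w unlift_none mul1r.
  by under eq_bigr do rewrite liftK /=.
under eq_bigr do rewrite mulrCA.
by rewrite -mulr_sumr wS mulr0.
Qed.

End RobustConstraint.

(** * SOS-convexity, minimisers and degrees *)

Lemma sos_convexD (R : realType) n (p1 p2 : {mpoly R[n]}) :
  sos_convex p1 -> sos_convex p2 -> sos_convex (p1 + p2).
Proof.
move=> [r1 [H1 E1]] [r2 [H2 E2]]; exists (r1 + r2)%N, (row_mx H1 H2).
rewrite tr_row_mx mul_row_col -E1 -E2; apply/matrixP => i j.
by rewrite !mxE !mderivD.
Qed.

Lemma sos_convexZ (R : realType) n (c : R) (p : {mpoly R[n]}) :
  0 <= c -> sos_convex p -> sos_convex (c *: p).
Proof.
move=> c0 [r [H E]]; exists r, ((Num.sqrt c)%:MP *: H).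
rewrite linearZ /= -scalemxAl -scalemxAr scalerA -E -mpolyCM -expr2 sqr_sqrtr //.
by apply/matrixP => i j; rewrite !mxE !mderivZ mul_mpolyC.
Qed.

Lemma sos_convexC (R : realType) n (c : R) : sos_convex (c%:MP_[n]).
Proof.
exists 0%N, 0; rewrite mul0mx; apply/matrixP => i j.
by rewrite !mxE mderivC mderiv0.
Qed.

Lemma sos_convex_sum (R : realType) n (I : Type) (r : seq I)
    (F : I -> {mpoly R[n]}) :
  (forall i, sos_convex (F i)) -> sos_convex (\sum_(i <- r) F i).
Proof.
move=> sF; elim/big_ind: _ => //; last exact: sos_convexD.
by rewrite -mpolyC0; exact: sos_convexC.
Qed.

(** The mean value theorem produces nonnegative derivatives arbitrarily close to [0], and
    the derivative is Lipschitz on the unit interval. *)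
Lemma poly_min_deriv_ge0 (R : rcfType) (P : {poly R}) :
  (forall s, 0 < s -> P.[0] <= P.[s]) -> 0 <= P^`().[0].
Proof.
move=> Pmin; have [k k1 kP] := poly_lipshitz P^`() 0 1.
rewrite -oppr_le0; apply: (@le0_affine_at0 _ _ k) => s s0 s1.
have [c] := poly_mvt P s0; rewrite in_itv /= subr0 => /andP[c0 cs] Ec.
have c_ge0 : 0 <= P^`().[c].
  by rewrite -(pmulr_lge0 _ s0) -Ec subr_ge0 Pmin.
have := kP 0 c; rewrite !in_itv /= lexx ler01 (ltW c0) (le_trans (ltW cs) s1).
move=> /(_ isT isT); rewrite subr0 (gtr0_norm c0).
have := ler_norm (P^`().[c] - P^`().[0]).
have : k * c <= k * s by rewrite ler_wpM2l ?(ltW cs) // (le_trans ler01).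
lra.
Qed.

Lemma minimizer_grad0 (R : realType) n (p : {mpoly R[n]}) (a : 'I_n -> R) :
  (forall x, p.@[a] <= p.@[x]) -> forall i, p^`M(i).@[a] = 0.
Proof.
move=> amin i.
have ge0 (d : 'I_n -> R) : 0 <= \sum_j p^`M(j).@[a] * d j.
  have [P [PE P' _]] := mpoly_line p a d; rewrite -P'.
  apply: poly_min_deriv_ge0 => s _; rewrite !PE.
  apply: le_trans (amin _); rewrite le_eqVlt; apply/orP; left; apply/eqP.
  by apply: meval_eq => j; rewrite mul0r addr0.
have dirE (c : R) : \sum_j p^`M(j).@[a] * (c * (j == i)%:R) = c * p^`M(i).@[a].
  rewrite (bigD1 i) //= eqxx mulr1 mulrC big1 ?addr0 // => j /negbTE ->.
  by rewrite !mulr0.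
have := ge0 (fun j => 1 * (j == i)%:R); have := ge0 (fun j => -1 * (j == i)%:R).
by rewrite !dirE => h1 h2; apply/eqP; rewrite eq_le; apply/andP; split; lra.
Qed.

Lemma sos_convex_min0_sos (R : realType) n (p : {mpoly R[n]}) (a : 'I_n -> R) :
  sos_convex p -> (forall x, 0 <= p.@[x]) -> p.@[a] = 0 -> sum_of_squares p.
Proof.
move=> sp p0 pa; apply: (sos_convex_critical_zero_sos sp pa).
by apply: minimizer_grad0 => x; rewrite pa.
Qed.

Lemma mpdeg_leD (R : realType) n (p1 p2 : {mpoly R[n]}) k :
  (mpdeg p1 <= k -> mpdeg p2 <= k -> mpdeg (p1 + p2) <= k)%N.
Proof.
rewrite /mpdeg -!subn1 !leq_subLR => h1 h2; apply: leq_trans (msizeD_le _ _) _.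
by rewrite geq_max h1.
Qed.

Lemma mpdeg_leZ (R : realType) n (c : R) (p : {mpoly R[n]}) k :
  (mpdeg p <= k -> mpdeg (c *: p) <= k)%N.
Proof.
rewrite /mpdeg -!subn1 !leq_subLR => h; exact: leq_trans (msizeZ_le _ _) h.
Qed.

Lemma mpdeg_leC (R : realType) n (c : R) k : (mpdeg (c%:MP_[n]) <= k)%N.
Proof. by rewrite /mpdeg msizeC; case: (c != 0). Qed.

Lemma mpdeg_le_sum (R : realType) n (I : Type) (r : seq I)
    (F : I -> {mpoly R[n]}) k :
  (forall i, mpdeg (F i) <= k)%N -> (mpdeg (\sum_(i <- r) F i) <= k)%N.
Proof.
move=> Fk; elim/big_ind: _ => //; last by move=> x y hx hy; exact: (mpdeg_leD hx hy).
by rewrite -mpolyC0; exact: mpdeg_leC.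
Qed.

(** * Duality for the robust problem *)

Section Duality.
Variables (R : realType) (n m : nat) (q l : 'I_m -> nat) (f : {mpoly R[n]}).
Variable g : forall i : 'I_m, 'I_(q i).+1 -> {mpoly R[n]}.
Variable A : forall i : 'I_m, 'M[R]_(l i, q i).
Variable b : forall i : 'I_m, 'cV[R]_(l i).
Hypothesis sos_f : sos_convex f.
Hypothesis sos_g : forall (i : 'I_m) (r : 'I_(q i).+1), sos_convex (g r).
Hypothesis V0 : forall i : 'I_m, uncertainty (A i) (b i) !=set0.

Let feasible_cone_le0 x : feasible g A b x ->
  forall i (w : 'I_(q i).+1 -> R), multiplier_cone (A i) (b i) w ->
  \sum_r w r * (g r).@[x] <= 0.
Proof.
move=> fx i w; apply: (multiplier_cone_le0 (a := fun r => (g r).@[x]) (V0 i)).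
exact: fx.
Qed.

Let lagrangian (w : forall i : 'I_m, 'I_(q i).+1 -> R) (mu : R) : {mpoly R[n]} :=
  f + \sum_(i < m) \sum_(r < (q i).+1) w i r *: g r - mu%:MP.

Let lagrangianE w mu x : (lagrangian w mu).@[x] =
  f.@[x] - mu + \sum_(i < m) \sum_(r < (q i).+1) w i r * (g r).@[x].
Proof.
rewrite /lagrangian mevalB mevalD mevalC addrAC; congr (_ + _).
rewrite raddf_sum; apply: eq_bigr => i _; rewrite raddf_sum /=.
by apply: eq_bigr => r _; rewrite mevalZ.
Qed.

Lemma weak_duality k mu x :
  dual_values f g A b k mu -> feasible g A b x -> mu <= f.@[x].
Proof.
move=> [w [[_ [s sE]] wA w0]] fx.
have : 0 <= (lagrangian w mu).@[x].
  rewrite /lagrangian sE raddf_sum sumr_ge0 // => h _.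
  by rewrite /= expr2 mevalM -expr2 sqr_ge0.
rewrite lagrangianE; suff : \sum_(i < m) \sum_(r < (q i).+1)
    w i r * (g r).@[x] <= 0 by lra.
by rewrite sumr_le0 // => i _; apply: feasible_cone_le0 => //; split.
Qed.

(* Decision vectors of the lifted problem: a point and, for every robust
   constraint, a dual certificate of the inner maximisation. *)
Let coord : finType := ('I_n + {i : 'I_m & 'I_(l i)})%type.
Let N := #|{: coord}|.
Let pt (z : 'rV[R]_N) (i : 'I_n) := z ord0 (enum_rank (inl i : coord)).
Let cert (z : 'rV[R]_N) (i : 'I_m) (j : 'I_(l i)) :=
  z ord0 (enum_rank (inr (Tagged (fun i => 'I_(l i)) j) : coord)).
Let lift_pt (x : 'I_n -> R) (y : forall i, 'I_(l i) -> R) : 'rV[R]_N :=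
  \row_k match enum_val k : coord with
         | inl i => x i | inr u => y (tag u) (tagged u) end.

Let pt_lift x y : pt (lift_pt x y) = x.
Proof. by apply/funext => i; rewrite /pt mxE enum_rankK. Qed.

Let cert_lift x y i j : @cert (lift_pt x y) i j = y i j.
Proof. by rewrite /cert mxE enum_rankK. Qed.

Let cnstr : finType := {i : 'I_m & 'I_(q i).+1}.
Let lifted (u : cnstr) (z : 'rV[R]_N) : R :=
  (g (tagged u)).@[pt z] +
  \sum_j cert z j * dual_slope (A (tag u)) (b (tag u)) (tagged u) j.
Let system (v : R) (o : option cnstr) (z : 'rV[R]_N) : R :=
  if o is Some u then lifted u z else f.@[pt z] - v.

Let systemP v o : convex_polynomial (system v o).
Proof.
case: o => [u|] /=.
  apply: (@convex_polynomialD _ _ (fun z => (g (tagged u)).@[pt z])).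
    exact/convex_polynomial_meval/sos_g.
  have := convex_polynomial_linear (index_enum 'I_(l (tag u)))
    (fun j => enum_rank (inr (Tagged (fun i => 'I_(l i)) j) : coord)) 0
    (fun j => dual_slope (A (tag u)) (b (tag u)) (tagged u) j).
  by congr convex_polynomial; apply/funext => z; rewrite add0r.
apply: (@convex_polynomialD _ _ (fun z => f.@[pt z]) (fun=> - v)).
  exact: convex_polynomial_meval.
have := @convex_polynomial_linear R N _ [::] (fun i : 'I_N => i) (- v) (fun=> 0).
by congr convex_polynomial; apply/funext => z; rewrite big_nil addr0.
Qed.

Let lifted_feasible z : (forall u, lifted u z <= 0) -> feasible g A b (pt z).
Proof.
move=> lz i v; apply: (@robust_farkas_converse R _ _ (A i) (b i)
  (fun r => (g r).@[pt z]) (@cert z i)) => r.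
exact: (lz (Tagged (fun i => 'I_(q i).+1) r)).
Qed.

Let feasible_lifted x : feasible g A b x ->
  exists y, forall u, lifted u (lift_pt x y) <= 0.
Proof.
move=> fx.
have ex i : exists z : 'I_(l i) -> R, forall r,
    (g r).@[x] + \sum_j z j * dual_slope (A i) (b i) r j <= 0.
  exact: (@robust_farkas R _ _ (A i) (b i) (fun r => (g r).@[x]) (V0 i) (fx i)).
exists (fun i => projT1 (cid (ex i))) => -[i r]; rewrite /lifted pt_lift /=.
under eq_bigr do rewrite cert_lift.
exact: (projT2 (cid (ex i))).
Qed.

Let strictly_feasible_lifted x :
  (forall i, compact (uncertainty (A i) (b i))) ->
  strictly_feasible g A b x ->
  exists y, forall u, lifted u (lift_pt x y) < 0.
Proof.
move=> cV fx.
have ex i : exists z : 'I_(l i) -> R, forall r,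
    (g r).@[x] + \sum_j z j * dual_slope (A i) (b i) r j < 0.
  exact: (@robust_farkas_strict R _ _ (A i) (b i) (fun r => (g r).@[x]) (V0 i)
    (cV i) (fx i)).
exists (fun i => projT1 (cid (ex i))) => -[i r]; rewrite /lifted pt_lift /=.
under eq_bigr do rewrite cert_lift.
exact: (projT2 (cid (ex i))).
Qed.

(** Closedness is applied to the lifted constraints together with [f - inf f <= 0]. *)
Lemma primal_attained :
  feasible g A b !=set0 -> has_lbound (primal_values f g A b) ->
  exists2 x, feasible g A b x & forall y, feasible g A b y -> f.@[x] <= f.@[y].
Proof.
move=> [x0 fx0] lb; set S := primal_values f g A b in lb.
have S0 : S !=set0 by exists f.@[x0], x0.
pose v := inf S.
have v_le x : feasible g A b x -> v <= f.@[x].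
  by move=> fx; apply: ge_inf => //; exists x.
have [o _|e e0|z zP] := @convex_polynomial_system_closed R N _
  (None :: [seq Some u | u : cnstr]) (system v).
- exact: systemP.
- have [_ [x fx <-] xv] := inf_adherent e0 (conj S0 lb).
  have [y yP] := feasible_lifted fx; exists (lift_pt x y) => -[u|] _ /=.
    exact: le_trans (yP u) (ltW e0).
  by rewrite pt_lift lerBlDl ltW.
have fz : feasible g A b (pt z).
  apply: lifted_feasible => u; apply: (zP (Some u)).
  by rewrite in_cons /= map_f // mem_enum.
exists (pt z) => // y fy; apply: le_trans (v_le y fy).
by have := zP None (mem_head _ _); rewrite /= subr_le0.
Qed.

(** The Lagrangian of the lifted problem is nonnegative for all values of the
    certificates [y], so its linear part in [y] vanishes, and this puts the
    multipliers into the cones. *)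
Lemma lagrange_multipliers v :
  (forall i, compact (uncertainty (A i) (b i))) ->
  strictly_feasible g A b !=set0 ->
  (forall x, feasible g A b x -> v <= f.@[x]) ->
  exists w : forall i : 'I_m, 'I_(q i).+1 -> R,
    (forall i, multiplier_cone (A i) (b i) (w i)) /\
    forall x, 0 <= (lagrangian w v).@[x].
Proof.
move=> cV [x0 sx0] v_le; pose s := None :: [seq Some u | u <- enum cnstr].
have [|o _|||[z _ zP]|w [w0 [o os wo] wP]] := @convex_alternative R 'rV[R]_N _ s
  (system v) setT.
- rewrite /= map_inj_uniq ?enum_uniq; last by move=> ? ? [].
  by rewrite andbT; apply/mapP => -[].
- exact/convex_polynomial_convex/systemP.
- by exists 0.
- by [].
- have := zP None (mem_head _ _); rewrite /= subr_lt0 ltNge v_le //.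
  apply: lifted_feasible => u; apply/ltW/(zP (Some u)).
  by rewrite in_cons /= map_f // mem_enum.
have {}wP z : 0 <= w None * (f.@[pt z] - v) + \sum_u w (Some u) * lifted u z.
  by have := wP z I; rewrite big_cons big_map big_enum.
(* otherwise the combination would be negative at the lifted Slater point *)
have wNone : 0 < w None.
  rewrite lt_neqAle w0 andbT; apply/eqP => /esym wN.
  case: o os wo => [u|] _ wo; last by rewrite wN ltxx in wo.
  have [y yP] := strictly_feasible_lifted cV sx0.
  have := wP (lift_pt x0 y); rewrite wN mul0r add0r leNgt => /negP; apply.
  rewrite (bigD1 u) //= ltr_wnDr ?pmulr_rlt0 //.
  by rewrite sumr_le0 // => u' _; rewrite mulr_ge0_le0 // ltW.
pose c (i : 'I_m) (r : 'I_(q i).+1) : R :=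
  w (Some (Tagged (fun i => 'I_(q i).+1) r)) / w None.
have c0 i r : 0 <= c i r by rewrite divr_ge0.
pose S (i : 'I_m) (j : 'I_(l i)) : R := \sum_r c i r * dual_slope (A i) (b i) r j.
have cP x y : 0 <= (lagrangian c v).@[x] + \sum_i \sum_j y i j * S i j.
  rewrite -(pmulr_rge0 _ wNone); have := wP (lift_pt x y); rewrite pt_lift.
  congr (0 <= _); rewrite lagrangianE -addrA [RHS]mulrDr; congr (_ + _).
  rewrite -big_split /= mulr_sumr.
  transitivity (\sum_(i < m) \sum_(r < (q i).+1) w None * (c i r *
      ((g r).@[x] + \sum_j y i j * dual_slope (A i) (b i) r j))).
    rewrite sig_big_dep /=; apply: eq_bigr => -[i r] _.
    rewrite /c /lifted pt_lift /= mulrA [w None * _]mulrC divfK ?gt_eqF //.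
    by congr (_ * (_ + _)); apply: eq_bigr => j _; rewrite cert_lift.
  apply: eq_bigr => i _; rewrite -mulr_sumr; congr (_ * _).
  under [LHS]eq_bigr do rewrite mulrDr mulr_sumr.
  rewrite big_split exchange_big /=; congr (_ + _); apply: eq_bigr => j _.
  by rewrite mulr_sumr; apply: eq_bigr => r _; rewrite mulrCA.
(* choosing the certificates proportional to the coefficients [S] kills them all
   at once *)
have S0 : \sum_i \sum_j S i j ^+ 2 = 0.
  apply: (@ge0_affine_slope0 _ (lagrangian c v).@[x0]) => t.
  have := cP x0 (fun i j => t * S i j).
  congr (0 <= _ + _); rewrite mulr_sumr; apply: eq_bigr => i _.
  by rewrite mulr_sumr; apply: eq_bigr => j _; rewrite -mulrA.
have Sij i j : S i j = 0.
  have Si0 k : 0 <= \sum_j S k j ^+ 2 by rewrite sumr_ge0 // => ? _; exact: sqr_ge0.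
  have Si : \sum_j S i j ^+ 2 = 0.
    move/eqP: S0; rewrite psumr_eq0 // => /allP/(_ i).
    by rewrite mem_index_enum => /(_ isT)/eqP.
  move/eqP: Si; rewrite psumr_eq0 => [/allP/(_ j)|k _]; last exact: sqr_ge0.
  by rewrite mem_index_enum => /(_ isT); rewrite sqrf_eq0 => /eqP.
exists c; split=> [i|x].
  split=> // j; apply/esym/eqP; rewrite -subr_eq0 -multiplier_coneE.
  by rewrite -/(S i j) Sij.
have := cP x (fun _ _ => 0); congr (0 <= _); rewrite [X in _ + X]big1 ?addr0 //.
by move=> i _; rewrite big1 // => j _; rewrite mul0r.
Qed.

(** Complementary slackness makes the Lagrangian vanish at the minimiser, so a
    nonnegative Lagrangian is a sum of squares. *)
Lemma dual_attained x k :
  (forall i, compact (uncertainty (A i) (b i))) ->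
  strictly_feasible g A b !=set0 ->
  feasible g A b x -> (forall y, feasible g A b y -> f.@[x] <= f.@[y]) ->
  (mpdeg f <= k)%N -> (forall i (r : 'I_(q i).+1), mpdeg (g r) <= k)%N ->
  dual_values f g A b k f.@[x].
Proof.
move=> cV sf fx xmin fk gk.
have [w [wcone wP]] := lagrange_multipliers cV sf xmin.
exists w; split=> [|i j|i r]; [|exact: (wcone i).2|exact: (wcone i).1].
rewrite -/(lagrangian w f.@[x]); split.
  apply: mpdeg_leD; last by rewrite -mpolyCN; exact: mpdeg_leC.
  apply: mpdeg_leD => //; apply: mpdeg_le_sum => i; apply: mpdeg_le_sum => r.
  exact/mpdeg_leZ/gk.
apply: (@sos_convex_min0_sos _ _ _ x) => //.
  apply: sos_convexD; last by rewrite -mpolyCN; exact: sos_convexC.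
  apply: sos_convexD => //; apply: sos_convex_sum => i; apply: sos_convex_sum => r.
  by apply: sos_convexZ => //; exact: (wcone i).1.
apply/eqP; rewrite eq_le wP andbT lagrangianE subrr add0r.
by rewrite sumr_le0 // => i _; exact: feasible_cone_le0.
Qed.

End Duality.

Theorem theorem3p1 (R : realType) (n m : nat) (q l : 'I_m -> nat)
    (f : {mpoly R[n]})
    (g : forall i : 'I_m, 'I_(q i).+1 -> {mpoly R[n]})
    (A : forall i : 'I_m, 'M[R]_(l i, q i))
    (b : forall i : 'I_m, 'cV[R]_(l i))
    (k0 : nat)
    (f_sosconvex : sos_convex f)
    (g_sosconvex : forall (i : 'I_m) (r : 'I_(q i).+1), sos_convex (g i r))
    (V_compact : forall i : 'I_m, compact (uncertainty (A i) (b i)))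
    (V_nonempty : forall i : 'I_m, uncertainty (A i) (b i) !=set0)
    (slater : strictly_feasible g A b !=set0)
    (f_bounded_below : has_lbound (primal_values f g A b))
    (k0_def : smallest_even_ge
       (maxn (mpdeg f) (\max_(i < m) \max_(r < (q i).+1) mpdeg (g i r))) k0) :
  exists v : R,
    is_min (primal_values f g A b) v /\ is_max (dual_values f g A b k0) v.
Proof.
have [x0 sx0] := slater.
have fx0 : feasible g A b x0 by move=> i v Vv; exact/ltW/sx0.
have [|x fx xmin] := primal_attained f_sosconvex g_sosconvex V_nonempty _
  f_bounded_below; first by exists x0.
have [_ + _] := k0_def; rewrite geq_max => /andP[fk0 /bigmax_leqP gk0].
have gk i (r : 'I_(q i).+1) : (mpdeg (g i r) <= k0)%N.
  by have /bigmax_leqP := gk0 i isT; exact.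
exists f.@[x]; split; split.
- by exists x.
- by move=> _ [y fy <-]; exact: xmin.
- exact: dual_attained.
- by move=> mu muD; exact: (weak_duality V_nonempty muD fx).
Qed.
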